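(* For every integer $k \ge 4$ there exists a real number $\beta_k$ such that $R_k \le \beta_k < \alpha_k$, where $\alpha_k = \frac{k!}{k^{k-1}}$. Moreover, for $k=5$ and $k=6$ one has the explicit bounds $$R_5 < \beta_5 = 0.190825 < 0.192 = \alpha_5, \qquad R_6 < \beta_6 = 0.0922787 < \tfrac{5}{54} = \alpha_6 .$$
   Context: Let $k \ge 2$ and $n \ge 1$ be integers. A code of length $n$ over the alphabet $\{1,2,\dots,k\}$ is a subset $C \subseteq \{1,2,\dots,k\}^n$. Such a code $C$ is a $k$-hash code if for every set of $k$ distinct codewords $c^{(1)},\dots,c^{(k)} \in C$ there is a coordinate $j \in \{1,\dots,n\}$ with $\{c^{(1)}_j,\dots,c^{(k)}_j\} = \{1,2,\dots,k\}$ (i.e. the $k$ codewords take pairwise distinct values in coordinate $j$). The rate of $C$ is $\frac{\log_2 |C|}{n}$. For fixed $k$, $R_k$ denotes the supremum, as $n \to \infty$ (i.e. the limit superior as $n\to\infty$), of the rate of a largest $k$-hash code of length $n$. The quantity $\alpha_k = k!/k^{k-1}$ is the Fredman–Komlós bound, known to satisfy $R_k \le \alpha_k$. *)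

(* Defs.v *)
From HB Require Import structures.
From mathcomp Require Import all_boot all_order all_algebra.
From mathcomp Require Import all_classical all_reals all_analysis.
Set Implicit Arguments. Unset Strict Implicit. Unset Printing Implicit Defensive.
Import Order.TTheory GRing.Theory Num.Theory.

(* Alphabet {1,...,k} is represented by 'I_k = {0,...,k-1};
   words of length n are finite functions 'I_n -> 'I_k. *)
Definition word (k n : nat) := {ffun 'I_n -> 'I_k}.

Definition is_hash_code (k n : nat) (C : {set word k n}) : Prop :=
  forall f : 'I_k -> word k n,
    injective f -> (forall i, f i \in C) ->
    exists j : 'I_n, [set f i j | i : 'I_k] = [set: 'I_k].

Definition max_hash_size (k n : nat) : nat :=
  \max_(C : {set word k n} | `[< is_hash_code C >]) #|C|.

Local Open Scope ring_scope.

Definition log2 {R : realType} (x : R) : R := ln x / ln 2.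

(* rate of a largest k-hash code of length n (n >= 1; value at n = 0 is
   irrelevant for the limsup, set to 0) *)
Definition hash_rate {R : realType} (k n : nat) : R :=
  if n is 0 then 0 else log2 (max_hash_size k n)%:R / n%:R.

Definition Rk {R : realType} (k : nat) : \bar R :=
  limn_esup (fun n => (hash_rate (R:=R) k n)%:E).

(* Fredman-Komlos bound alpha_k = k! / k^(k-1) *)
Definition alpha {R : realType} (k : nat) : R :=
  (k`!)%:R / (k ^ (k.-1))%:R.

(* Main.v *)
Require Import Defs.
From HB Require Import structures.
From mathcomp Require Import all_boot all_order all_algebra.
From mathcomp Require Import all_classical all_reals all_analysis.
From mathcomp Require Import ring lra.
Set Implicit Arguments. Unset Strict Implicit. Unset Printing Implicit Defensive.
Import Order.TTheory GRing.Theory Num.Theory.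
Local Open Scope ring_scope.

(** Write [k = h + 2]. Fixing [h] distinct codewords, every coordinate where
    they are pairwise distinct splits the remaining codewords into two classes
    and isolated ones, and these bipartite graphs cover the complete graph;
    Hansel's lemma then bounds [log2 N] by the sum over the coordinates of the
    proportion of non-isolated codewords. If the [h] words are sampled from a
    subcode [D] of [C], coordinate [j] contributes [mixed_sum p f h], where [p]
    and [f] are the letter frequencies of [D] and [C] at [j].

    With [D = C] the contribution is at most [alpha k], with equality only at the
    uniform distribution [f] (Fredman-Komlos). With [D] a largest class of words
    sharing their first [l] letters, [k ^ l] slightly below [N], the first [l]
    coordinates contribute nothing, while the others exceed [alpha k] by at most
    [kappa k / alpha k] times the deficit of [f] in the first estimate. Hence a
    suitable average of the two estimates gives
    [log2 N <= alpha k * (n - t * l)] up to lower order terms, with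
    [t = alpha k / (alpha k + kappa k)] and [l] close to [log2 N / log2 k]. *)

(** * Sums over injective tuples of letters *)

Section InjectiveSum.
Variables (R : realFieldType) (T : finType).
Implicit Types (p q : T -> R) (A : {set T}).

(** [j!] times the [j]-th elementary symmetric polynomial of [p] on [A], as a sum over injective
    [j]-tuples of letters. *)
Fixpoint inj_sum p (j : nat) A : R :=
  if j is j'.+1 then \sum_(a in A) p a * inj_sum p j' (A :\ a) else 1.

Lemma setD1C A a b : A :\ a :\ b = A :\ b :\ a.
Proof. by rewrite !finset.setDDl finset.setUC. Qed.

Lemma exchange_big_setD1 A (F : T -> T -> R) :
  \sum_(a in A) \sum_(b in A :\ a) F a b = \sum_(b in A) \sum_(a in A :\ b) F a b.
Proof.
rewrite (exchange_big_dep (mem A)) /=; last by move=> a b _; rewrite !inE => /andP[].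
apply: eq_bigr => b bA; apply: eq_bigl => a.
by rewrite !inE bA andbT eq_sym andbC.
Qed.

(** Split the injective tuples by whether [b] occurs; if it does, it sits at one of [j + 1]
    positions. *)
Lemma inj_sum_setD1 p j A b : b \in A ->
  inj_sum p j.+1 A =
  inj_sum p j.+1 (A :\ b) + j.+1%:R * p b * inj_sum p j (A :\ b).
Proof.
elim: j A => [|j IH] A bA.
  by rewrite /= (big_setD1 b) //= addrC mul1r.
have E (B : {set T}) : inj_sum p j.+2 B = \sum_(a in B) p a * inj_sum p j.+1 (B :\ a) by [].
rewrite E (big_setD1 b) //= -/(inj_sum p j.+1 (A :\ b)).
rewrite -/(inj_sum p j.+2 (A :\ b)).
have -> : \sum_(i in A :\ b) p i * inj_sum p j.+1 (A :\ i) =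
   inj_sum p j.+2 (A :\ b) + j.+1%:R * p b * inj_sum p j.+1 (A :\ b).
  rewrite E [in X in _ = _ + X]/= mulr_sumr -big_split /=.
  apply: eq_bigr => a; rewrite !inE => /andP[ab aA].
  rewrite -/(inj_sum p j.+1 (A :\ a)) -/(inj_sum p j.+1 (A :\ b :\ a)).
  rewrite (IH (A :\ a)); last by rewrite !inE eq_sym ab.
  by rewrite (setD1C A a b); ring.
rewrite [in RHS]mulrSr; ring.
Qed.

Lemma sum_inj_sum_setD1 p j A :
  \sum_(a in A) inj_sum p j (A :\ a) = (#|A|%:R - j%:R) * inj_sum p j A.
Proof.
case: j => [|j]; first by rewrite /= sumr_const subr0 mulr1.
transitivity (\sum_(a in A) (inj_sum p j.+1 A - j.+1%:R * (p a * inj_sum p j (A :\ a)))).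
  by apply: eq_bigr => a aA; rewrite (inj_sum_setD1 p j aA); ring.
by rewrite sumrB sumr_const -mulr_sumr -/(inj_sum p j.+1 A) -mulr_natl; ring.
Qed.

Definition spread p (j : nat) A : R :=
  \sum_(a in A) \sum_(b in A :\ a) (p a - p b) ^+ 2 * inj_sum p j (A :\ a :\ b).

(** Newton-type inequality between consecutive symmetric sums, with its defect in closed form:
    expand the squares in [spread]. The exact defect matters, as [mixed_sum_le_spread] cancels a
    term against it. *)
Lemma inj_sum_spread p j A :
  (#|A|%:R - j.+1%:R) * inj_sum p 1 A * inj_sum p j.+1 A - #|A|%:R * inj_sum p j.+2 A
  = j.+1%:R / 2 * spread p j A.
Proof.
have sq : j.+1%:R * \sum_(a in A) p a ^+ 2 * inj_sum p j (A :\ a) =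
    inj_sum p 1 A * inj_sum p j.+1 A - inj_sum p j.+2 A.
  have -> : inj_sum p 1 A * inj_sum p j.+1 A = \sum_(a in A) p a * inj_sum p j.+1 A.
    by rewrite mulr_suml; apply: eq_bigr => a _; rewrite /= mulr1.
  have -> : inj_sum p j.+2 A = \sum_(a in A) p a * inj_sum p j.+1 (A :\ a) by [].
  rewrite -sumrB mulr_sumr.
  by apply: eq_bigr => a aA; rewrite (inj_sum_setD1 p j aA); ring.
have half : \sum_(a in A) \sum_(b in A :\ a) p a ^+ 2 * inj_sum p j (A :\ a :\ b) =
   (#|A|%:R - j.+1%:R) * \sum_(a in A) p a ^+ 2 * inj_sum p j (A :\ a).
  rewrite mulr_sumr; apply: eq_bigr => a aA.
  rewrite -mulr_sumr sum_inj_sum_setD1.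
  have -> : #|A|%:R = #|A :\ a|%:R + 1 :> R by rewrite (cardsD1 a) aA add1n -natr1.
  by rewrite -natr1; ring.
have -> : spread p j A =
   \sum_(a in A) \sum_(b in A :\ a) p a ^+ 2 * inj_sum p j (A :\ a :\ b)
   + \sum_(a in A) \sum_(b in A :\ a) p b ^+ 2 * inj_sum p j (A :\ a :\ b)
   - 2 * inj_sum p j.+2 A.
  have -> : inj_sum p j.+2 A =
      \sum_(a in A) \sum_(b in A :\ a) p a * p b * inj_sum p j (A :\ a :\ b).
    rewrite /=; apply: eq_bigr => a _; rewrite mulr_sumr.
    by apply: eq_bigr => b _; rewrite mulrA.
  rewrite mulr_sumr -big_split -sumrB; apply: eq_bigr => a _ /=.
  rewrite mulr_sumr -big_split -sumrB; apply: eq_bigr => b _ /=.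
  ring.
rewrite [X in _ + X - _]exchange_big_setD1.
under [X in _ + X - _]eq_bigr do under eq_bigr do rewrite setD1C.
rewrite half.
transitivity ((#|A|%:R - j.+1%:R) * (j.+1%:R * \sum_(a in A) p a ^+ 2 * inj_sum p j (A :\ a))
   - j.+1%:R * inj_sum p j.+2 A).
  by rewrite sq; ring.
by field.
Qed.

Lemma inj_sum_ge0 p j A : (forall a, 0 <= p a) -> 0 <= inj_sum p j A.
Proof.
move=> p0; elim: j A => [|j IH] A /=; first exact: ler01.
by apply: sumr_ge0 => a _; rewrite mulr_ge0.
Qed.

Lemma spread_ge0 p j A : (forall a, 0 <= p a) -> 0 <= spread p j A.
Proof.
move=> p0; apply: sumr_ge0 => a _; apply: sumr_ge0 => b _.
by rewrite mulr_ge0 ?sqr_ge0 ?inj_sum_ge0.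
Qed.

Lemma inj_sum1 p A : inj_sum p 1 A = \sum_(a in A) p a.
Proof. by rewrite /=; under eq_bigr do rewrite mulr1. Qed.

Lemma inj_sum_succ_le p j A : (forall a, 0 <= p a) -> inj_sum p 1 A <= 1 ->
  (j <= #|A|)%N ->
  #|A|%:R * inj_sum p j.+1 A <= (#|A|%:R - j%:R) * inj_sum p j A.
Proof.
move=> p0 p1; case: j => [|j] jA.
  by rewrite subr0 [inj_sum p 0 A]/= mulr1 ler_piMr ?ler0n.
have s0 : 0 <= j.+1%:R / 2 * spread p j A.
  by rewrite mulr_ge0 ?spread_ge0 ?divr_ge0 ?ler0n.
rewrite -inj_sum_spread subr_ge0 in s0; apply: (le_trans s0).
rewrite -mulrA ler_wpM2l ?subr_ge0 ?ler_nat //.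
by rewrite ler_piMl // inj_sum_ge0.
Qed.

Lemma inj_sum_le_step p i j A : (forall a, 0 <= p a) -> inj_sum p 1 A <= 1 ->
  (i + j <= #|A|)%N ->
  #|A|%:R ^+ j * inj_sum p (i + j) A <= ((#|A| - i) ^_ j)%:R * inj_sum p i A.
Proof.
move=> p0 p1; elim: j => [|j IH] ijA.
  by rewrite addn0 expr0 ffactn0.
have ijA' : (i + j <= #|A|)%N by apply: leq_trans ijA; rewrite leq_add2l.
rewrite addnS exprSr -mulrA.
have le1 := inj_sum_succ_le p0 p1 ijA'.
apply: (le_trans (ler_wpM2l _ le1)); first by rewrite exprn_ge0 ?ler0n.
rewrite ffactnSr -subnDA natrM mulrCA natrB // mulrC [X in _ <= X * _]mulrC mulrC.
rewrite -[X in _ <= X]mulrA ler_wpM2l ?IH //.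
by rewrite subr_ge0 ler_nat.
Qed.

(** Maclaurin's inequality, with equality at the uniform distribution on [A]. *)
Lemma inj_sum_le p j A : (forall a, 0 <= p a) -> inj_sum p 1 A <= 1 ->
  (j <= #|A|)%N -> #|A|%:R ^+ j * inj_sum p j A <= (#|A| ^_ j)%:R.
Proof.
by move=> p0 p1 jA; have := @inj_sum_le_step p 0 j A p0 p1 jA; rewrite subn0 add0n mulr1.
Qed.

Lemma inj_sumZ (c : R) p h A :
  inj_sum (fun a => c * p a) h A = c ^+ h * inj_sum p h A.
Proof.
elim: h A => [|h IH] A /=; first by rewrite mul1r.
rewrite mulr_sumr; apply: eq_bigr => a _; rewrite IH exprS; ring.
Qed.

Lemma eq_inj_sum p q h A :
  p =1 q -> inj_sum p h A = inj_sum q h A.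
Proof.
move=> e; elim: h A => [|h IH] A //=.
by apply: eq_bigr => a _; rewrite IH e.
Qed.

End InjectiveSum.

(** * Comparison of mixed sums with the Fredman-Komlos value *)

Section Mixed.
Variables (R : realType) (T : finType).
Implicit Types (p f : T -> R).

(** For distributions [p] and [f]: the probability that [h] letters drawn from [p] and one from [f],
    independently, are pairwise distinct. *)
Definition mixed_sum p f h : R := \sum_b f b * inj_sum p h ([set: T] :\ b).

Lemma mixed_sum_diag p h : mixed_sum p p h = inj_sum p h.+1 [set: T].
Proof. by rewrite /mixed_sum /=; apply: eq_bigl => b; rewrite inE. Qed.

Lemma sum_setT (F : T -> R) : \sum_(a in [set: T]) F a = \sum_a F a.
Proof. by apply: eq_bigl => a; rewrite inE. Qed.

(** Exact form of Chebyshev's sum inequality: pairwise differences measure the correlation of [f]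
    and [G]. *)
Lemma chebyshev_sum_identity (f G : T -> R) :
  \sum_a \sum_(b in [set: T] :\ a) (f a - f b) * (G a - G b) =
  2 * (#|T|%:R * \sum_a f a * G a - (\sum_a f a) * \sum_a G a).
Proof.
transitivity (\sum_a \sum_b (f a - f b) * (G a - G b)).
  apply: eq_bigr => a _; rewrite -[RHS]sum_setT [RHS](big_setD1 a) ?inE //=.
  by rewrite subrr mul0r add0r.
transitivity (\sum_a (#|T|%:R * (f a * G a) + \sum_b f b * G b
    - f a * \sum_b G b - (\sum_b f b) * G a)).
  apply: eq_bigr => a _.
  rewrite mulr_sumr mulr_suml mulr_natl -sumr_const -!(sumrN, big_split) /=.
  by apply: eq_bigr => b _; ring.
rewrite !big_split /= !sumrN -mulr_sumr -!mulr_suml -mulr_sumr sumr_const -mulr_natl.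
rewrite /=; ring.
Qed.

Lemma inj_sum_sub_le1 p (A : {set T}) : (forall a, 0 <= p a) -> \sum_a p a = 1 ->
  inj_sum p 1 A <= 1.
Proof.
move=> p0 p1; rewrite inj_sum1 -p1 [leRHS](bigID (mem A)) /= lerDl.
exact: sumr_ge0.
Qed.

(* The first factor is the maximum of [inj_sum p (k - 3)] over distributions [p]
   on [k - 2] letters. *)
Definition kappa (k : nat) : R :=
  ((k.-2)`!%:R / (k.-2)%:R ^+ (k.-2).-1) * (k.-2)%:R * (k.-1)%:R / (4 * (k.-2).-1%:R).

(** One factor is bounded by its maximum on [g + 2] letters, the other by a step down to
    [inj_sum p g], the weight occurring in [spread p g]. *)
Lemma inj_sum_pair_sqr_le p g (a b : T) : #|T| = g.+4 ->
  (forall a, 0 <= p a) -> \sum_a p a = 1 -> a != b ->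
  inj_sum p g.+1 ([set: T] :\ a :\ b) ^+ 2 <=
  ((g.+2)`!%:R / g.+2%:R ^+ g.+1) * (2 / g.+2%:R) * inj_sum p g ([set: T] :\ a :\ b).
Proof.
move=> cT p0 p1 ab; set A := _ :\ _ :\ _.
have cA : #|A| = g.+2.
  apply/eqP; rewrite -(eqn_add2l 2) -[X in _ == X]/(g.+4) -cT -cardsT.
  rewrite (cardsD1 a [set: T]) inE (cardsD1 b ([set: T] :\ a)) !inE (eq_sym b a) ab /=.
  by [].
have A1 : inj_sum p 1 A <= 1 by exact: inj_sum_sub_le1.
have g2 : 0 < g.+2%:R :> R by rewrite ltr0n.
have leM : inj_sum p g.+1 A <= (g.+2)`!%:R / g.+2%:R ^+ g.+1.
  have := @inj_sum_le _ _ p g.+1 A p0 A1; rewrite cA => /(_ (leqnSn _)).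
  have -> : (g.+2 ^_ g.+1 = (g.+2)`!)%N.
    by rewrite -[RHS](ffact_fact (leqnSn g.+1)) subSnn muln1.
  by rewrite ler_pdivlMr ?exprn_gt0 // mulrC.
have leN : inj_sum p g.+1 A <= 2 / g.+2%:R * inj_sum p g A.
  have := @inj_sum_succ_le _ _ p g A p0 A1; rewrite cA => /(_ (leqW (leqnSn _))).
  have -> : g.+2%:R - g%:R = 2 :> R by rewrite -addn2 natrD; ring.
  by rewrite mulrAC ler_pdivlMr // mulrC.
rewrite expr2 -mulrA; apply: ler_pM => //; exact: inj_sum_ge0.
Qed.

(** By the Chebyshev identity the mixed sum is its value at uniform [f] plus products of
    differences. AM-GM splits these into [spread f 0] and [spread p g]; [inj_sum_spread] evaluates
    the latter, and Maclaurin bounds the rest by [alpha]. *)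
Lemma mixed_sum_le_spread p f g : #|T| = g.+4 ->
  (forall a, 0 <= p a) -> \sum_a p a = 1 -> \sum_a f a = 1 ->
  mixed_sum p f g.+2 <=
  alpha g.+4 + kappa g.+4 / (2 * g.+3%:R) * spread f 0 [set: T].
Proof.
move=> cT p0 p1 f1.
have cS : #|[set: T]| = g.+4 by rewrite cardsT.
pose mu : R := (g.+2)`!%:R / g.+2%:R ^+ g.+1.
have mu0 : 0 < mu by rewrite divr_gt0 ?exprn_gt0 ?ltr0n ?fact_gt0.
pose n : R := g.+4%:R.
have n0 : 0 < n by rewrite ltr0n.
have g10 : 0 < g.+1%:R :> R by rewrite ltr0n.
have g20 : 0 < g.+2%:R :> R by rewrite ltr0n.
have g30 : 0 < g.+3%:R :> R by rewrite ltr0n.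
pose lam := n * mu / (4 * g.+1%:R).
pose w j := inj_sum p j [set: T].
pose G b := inj_sum p g.+2 ([set: T] :\ b).
have sumG : \sum_b G b = 2 * w g.+2.
  rewrite -sum_setT sum_inj_sum_setD1 cS; congr (_ * _).
  by rewrite -[in g.+4%:R]addn2 natrD; ring.
(* Expand each sum along the other letter: the common term avoiding both [a] and [b] cancels. *)
have dG a b : b \in [set: T] :\ a ->
    G a - G b = - (g.+2%:R * ((p a - p b) * inj_sum p g.+1 ([set: T] :\ a :\ b))).
  rewrite !inE andbT => ba.
  rewrite /G (@inj_sum_setD1 _ _ p g.+1 _ b) ?inE ?ba //.
  rewrite (@inj_sum_setD1 _ _ p g.+1 ([set: T] :\ b) a) ?inE 1?eq_sym ?ba //.
  by rewrite (setD1C _ b a); ring.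
have E := chebyshev_sum_identity f G.
rewrite cT f1 mul1r sumG -/n -/(mixed_sum p f g.+2) in E.
have bound : \sum_a \sum_(b in [set: T] :\ a) (f a - f b) * (G a - G b) <=
   g.+2%:R * (lam * spread f 0 [set: T] +
              2 * g.+1%:R / (n * g.+2%:R) * spread p g [set: T]).
  rewrite /spread !mulr_sumr -big_split mulr_sumr sum_setT; apply: ler_sum => a _ /=.
  rewrite !mulr_sumr -big_split mulr_sumr; apply: ler_sum => b ba /=.
  have Q2 : inj_sum p g.+1 ([set: T] :\ a :\ b) ^+ 2 <=
      mu * (2 / g.+2%:R) * inj_sum p g ([set: T] :\ a :\ b).
    by apply: inj_sum_pair_sqr_le => //; move: ba; rewrite !inE andbT eq_sym.
  rewrite dG //; set F := f a - f b; set P := p a - p b.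
  move: Q2; set Q := inj_sum p g.+1 _; set q := inj_sum p g _ => Q2.
  rewrite mulrN mulrCA -mulrN ler_wpM2l ?(ltW g20) // mulr1.
  have lam0 : 0 < lam by rewrite /lam divr_gt0 ?mulr_gt0.
  (* AM-GM with the weight lam that makes the p-part cancel against w g.+2 *)
  apply: (@le_trans _ _ (lam * F ^+ 2 + (P * Q) ^+ 2 / (4 * lam))).
    rewrite -subr_ge0.
    have -> : lam * F ^+ 2 + (P * Q) ^+ 2 / (4 * lam) - - (F * (P * Q)) =
       (2 * lam * F + P * Q) ^+ 2 / (4 * lam).
      by field; rewrite gt_eqF.
    by rewrite divr_ge0 ?sqr_ge0 // mulr_ge0 // ltW.
  rewrite lerD2l exprMn.
  apply: (@le_trans _ _ (P ^+ 2 * (mu * (2 / g.+2%:R) * q) / (4 * lam))).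
    by rewrite ler_wpM2r ?invr_ge0 ?mulr_ge0 ?(ltW lam0) // ler_wpM2l ?sqr_ge0.
  rewrite le_eqVlt; apply/orP; left; apply/eqP; rewrite /lam; field.
  by rewrite !gt_eqF.
have sp := inj_sum_spread p g [set: T].
rewrite cS [inj_sum p 1 _]inj_sum1 sum_setT p1 mulr1 in sp.
have sp' : 2 * g.+1%:R / (n * g.+2%:R) * spread p g [set: T] =
    4 / (n * g.+2%:R) * (3 * w g.+1 - n * w g.+2).
  have -> : 3 * w g.+1 - n * w g.+2 = g.+1%:R / 2 * spread p g [set: T].
    by rewrite -sp /w -/n; congr (_ * _ - _); rewrite /n -[g.+4](addn3 g.+1) natrD; ring.
  by field; rewrite !gt_eqF.
(* The 6 is [3!], the quotient of [(g + 4)!] by the falling factorial. *)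
have wle : 6 * w g.+1 <= n ^+ 2 * alpha g.+4.
  have := @inj_sum_le _ _ p g.+1 [set: T] p0 (inj_sum_sub_le1 _ p0 p1).
  rewrite cS => /(_ (leqW (leqW (leqnSn _)))) le1.
  rewrite -(ler_pM2l (exprn_gt0 g.+1 n0)) mulrCA.
  apply: (@le_trans _ _ (6 * (g.+4 ^_ g.+1)%:R)); first by rewrite ler_wpM2l.
  have -> : alpha g.+4 = (6 * (g.+4 ^_ g.+1)%:R) / n ^+ g.+3 :> R.
    rewrite /alpha natrX; congr (_ / _).
    have le4 : (g.+1 <= g.+4)%N by rewrite -[g.+4](addn3 g.+1) leq_addr.
    rewrite -(ffact_fact le4) natrM mulrC; congr (_ * _).
    by have -> : (g.+4 - g.+1 = 3)%N by rewrite -[g.+4](addn3 g.+1) addKn.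
  rewrite mulrA -exprD addn2 mulrCA divff ?mulr1 //.
  by rewrite expf_neq0 // gt_eqF.
(* This identity dictates the value of [kappa]. *)
have kE : kappa g.+4 / (2 * g.+3%:R) = g.+2%:R * lam / (2 * n).
  rewrite /kappa /= -/mu /lam; field.
  by rewrite !gt_eqF.
rewrite kE -(ler_pM2l n0).
move: bound; rewrite E sp'.
set s := spread f 0 _; set ps := mixed_sum _ _ _ => bound.
have e1 : g.+2%:R * (lam * s + 4 / (n * g.+2%:R) * (3 * w g.+1 - n * w g.+2)) =
  g.+2%:R * lam * s + 12 / n * w g.+1 - 4 * w g.+2.
  by field; rewrite !gt_eqF.
have e2 : n * (alpha g.+4 + g.+2%:R * lam / (2 * n) * s) =
   n * alpha g.+4 + g.+2%:R * lam * s / 2.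
  by field; rewrite gt_eqF.
have e3 : 6 / n * w g.+1 <= n * alpha g.+4.
  by rewrite mulrAC ler_pdivrMr // mulrAC -expr2.
rewrite e1 in bound; rewrite e2.
have e4 : 12 / n * w g.+1 = 2 * (6 / n * w g.+1) by field; rewrite gt_eqF.
rewrite e4 in bound; move: bound e3.
move: (n * ps) (_ / n * _) (n * alpha _) (_ * lam * s) (w g.+2) => x1 x2 x3 x4 x5.
lra.
Qed.

(** [spread f 0] depends only on [inj_sum f 2], and stepping from 2 to [k - 1] letters bounds the
    Fredman-Komlos value of [f] by a multiple of that sum. *)
Lemma spread0_le_deficit f g : #|T| = g.+4 ->
  (forall a, 0 <= f a) -> \sum_a f a = 1 ->
  alpha g.+4 * spread f 0 [set: T] <=
  2 * g.+3%:R * (alpha g.+4 - inj_sum f g.+3 [set: T]).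
Proof.
move=> cT f0 f1.
have cS : #|[set: T]| = g.+4 by rewrite cardsT.
pose n : R := g.+4%:R.
have n0 : 0 < n by rewrite ltr0n.
have n10 : 0 < g.+3%:R :> R by rewrite ltr0n.
have sp := inj_sum_spread f 0 [set: T].
rewrite cS [inj_sum f 1 _]inj_sum1 sum_setT f1 !mulr1 -/n in sp.
have -> : spread f 0 [set: T] = 2 * (g.+3%:R - n * inj_sum f 2 [set: T]).
  have -> : g.+3%:R = n - 1 by rewrite /n -natr1; ring.
  by rewrite sp; field.
have := @inj_sum_le_step _ _ f 2 g.+1 [set: T] f0 (inj_sum_sub_le1 _ f0 f1).
rewrite cS -/n add2n => /(_ (leqnSn _)) le1.
have al : g.+3%:R * n * ((g.+2)`!)%:R = alpha g.+4 * n ^+ g.+3.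
  rewrite /alpha natrX -/n divfK ?expf_neq0 ?gt_eqF //.
  by rewrite 2!factS !natrM -/n; ring.
have le2 : g.+3%:R * inj_sum f g.+3 [set: T] <= alpha g.+4 * n * inj_sum f 2 [set: T].
  rewrite -(ler_pM2l (exprn_gt0 g.+2 n0)).
  have -> : n ^+ g.+2 * (alpha g.+4 * n * inj_sum f 2 [set: T]) =
     g.+3%:R * n * (((g.+4 - 2) ^_ g.+1)%:R * inj_sum f 2 [set: T]).
    have -> : ((g.+4 - 2) ^_ g.+1 = (g.+2)`!)%N.
      by rewrite !subSS subn0 -[RHS](ffact_fact (leqnSn g.+1)) subSnn muln1.
    have -> : n ^+ g.+2 * (alpha g.+4 * n * inj_sum f 2 [set: T]) =
        (alpha g.+4 * n ^+ g.+3) * inj_sum f 2 [set: T] by rewrite (exprS _ g.+2); ring.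
    by rewrite -al; ring.
  have -> : n ^+ g.+2 * (g.+3%:R * inj_sum f g.+3 [set: T]) =
    g.+3%:R * n * (n ^+ g.+1 * inj_sum f g.+3 [set: T]) by rewrite (exprS _ g.+1); ring.
  by rewrite ler_wpM2l // mulr_ge0 ?ler0n ?ltW.
lra.
Qed.

Lemma alpha_gt0 k : 0 < alpha k :> R.
Proof.
rewrite /alpha divr_gt0 ?ltr0n ?fact_gt0 //.
by case: k => // k; rewrite expn_gt0.
Qed.

Lemma kappa_gt0 g : 0 < kappa g.+4.
Proof.
have nat_gt0 m : (0 < m)%N -> 0 < m%:R :> R by rewrite ltr0n.
rewrite /kappa /= divr_gt0 // ?mulr_gt0 // ?nat_gt0 // divr_gt0 ?nat_gt0 ?fact_gt0 //.
Qed.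

(** The weights eliminate [spread f 0] between the two preceding estimates: any excess over [alpha]
    is paid for by the deficit of [f]. *)
Lemma mixed_sum_le_deficit p f k : (4 <= k)%N -> #|T| = k ->
  (forall a, 0 <= p a) -> \sum_a p a = 1 ->
  (forall a, 0 <= f a) -> \sum_a f a = 1 ->
  alpha k * mixed_sum p f k.-2 + kappa k * mixed_sum f f k.-2 <=
  alpha k * (alpha k + kappa k).
Proof.
case: k => [|[|[|[|g]]]] // _ cT p0 p1 f0 f1; rewrite mixed_sum_diag [_.-2]/=.
have le1 := mixed_sum_le_spread cT p0 p1 f1.
have le2 := spread0_le_deficit cT f0 f1.
have le3 := ler_wpM2l (ltW (alpha_gt0 g.+4)) le1.
have n10 : 0 < g.+3%:R :> R by rewrite ltr0n.
have k0 : 0 <= kappa g.+4 / (2 * g.+3%:R).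
  by rewrite divr_ge0 ?mulr_ge0 ?(ltW n10) ?(ltW (kappa_gt0 g)).
have le4 := ler_wpM2l k0 le2.
have e : kappa g.+4 / (2 * g.+3%:R) *
   (2 * g.+3%:R * (alpha g.+4 - inj_sum f g.+3 [set: T])) =
   kappa g.+4 * (alpha g.+4 - inj_sum f g.+3 [set: T]).
  by field; rewrite gt_eqF.
rewrite e in le4; move: le3 le4.
move: (kappa g.+4 / _) => c; move: (alpha _) (kappa _) (spread _ _ _) => al ka s.
move: (mixed_sum _ _ _) (inj_sum _ _ _) => x y; lra.
Qed.

End Mixed.

(** * Hansel's lemma *)

Section Hansel.
Variables (R : realType) (V I : finType).

(** Pick a side of each bipartite graph at random; [y] survives if it lies on the picked side
    wherever [on y i] holds, which has probability [2 ^ - deg y]. Two separated vertices never both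
    survive, so the expected number of survivors is at most 1. *)
Lemma kraft_bipartite (D : {set V}) (on : V -> I -> bool) (side : V -> I -> bool) :
  {in D &, forall y z, y != z -> exists i, [&& on y i, on z i & side y i != side z i]} ->
  \sum_(y in D) (2^-1 : R) ^+ #|[set i | on y i]| <= 1.
Proof.
move=> sep.
pose ok y i (b : bool) := ~~ on y i || (b == side y i).
have E y : (2^-1 : R) ^+ #|[set i | on y i]| =
    \sum_(c : {ffun I -> bool}) \prod_i (2^-1 * (ok y i (c i))%:R).
  rewrite -(bigA_distr_bigA (fun i b => 2^-1 * (ok y i b)%:R : R)) /=.
  rewrite -prodr_const big_mkcond /=; apply: eq_bigr => i _.
  rewrite inE big_bool /ok; case: (on y i); case: (side y i) => /=; by field.
under eq_bigr do rewrite E.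
rewrite exchange_big /=.
apply: (@le_trans _ _ (\sum_(c : {ffun I -> bool}) \prod_(i : I) (2^-1 : R))); last first.
  rewrite -(bigA_distr_bigA (fun (i : I) (b : bool) => 2^-1 : R)) /= big1 // => i _.
  by rewrite big_bool /=; field.
apply: ler_sum => c _.
under eq_bigr do rewrite big_split /=.
rewrite -mulr_sumr ler_piMr ?prodr_ge0 //.
under eq_bigr do rewrite -natr_prod.
rewrite -natr_sum -[leRHS]/(1%:R) ler_nat.
have Ey y : (\prod_i nat_of_bool (ok y i (c i)) = [forall i, ok y i (c i)])%N.
  case: forallP => [H|H].
    by rewrite big1 // => i _; rewrite H.
  apply/eqP; rewrite -leqn0 leqNgt; apply/negP => P.
  apply: H => i; move: P; rewrite (bigD1 i) //= muln_gt0.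
  by case: (ok y i (c i)).
under eq_bigr do rewrite Ey.
rewrite -big_mkcondr sum1dep_card /=.
rewrite cardsE; apply/card_le1P => y /andP[yD /forallP oky] z.
rewrite !inE; apply/idP/eqP => [/andP[zD /forallP okz]|->]; last first.
  by apply/andP; split => //; apply/forallP.
apply/eqP; apply: contraT => zy.
have [i /and3P[oy oz]] := sep z y zD yD zy.
have := oky i; have := okz i; rewrite /ok oy oz /= => /eqP <- /eqP <-.
by rewrite eqxx.
Qed.

(** Apply [ln x <= x - 1] to [#|D| * 2 ^ - deg y] and sum over [y]; the Kraft inequality makes the
    total nonpositive. *)
Lemma hansel (D : {set V}) (on : V -> I -> bool) (side : V -> I -> bool) :
  {in D &, forall y z, y != z -> exists i, [&& on y i, on z i & side y i != side z i]} ->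
  #|D|%:R * ln #|D|%:R <= ln 2 * \sum_i \sum_(y in D) (on y i)%:R :> R.
Proof.
move=> /kraft_bipartite kr.
have [D0|D0] := posnP #|D|.
  rewrite D0 mul0r mulr_ge0 ?ln_ge0 ?ler1n // sumr_ge0 // => i _.
  by rewrite sumr_ge0.
have dR : 0 < #|D|%:R :> R by rewrite ltr0n.
rewrite exchange_big /= -subr_le0.
have -> : #|D|%:R * ln #|D|%:R - ln 2 * \sum_(y in D) \sum_i (on y i)%:R =
   \sum_(y in D) ln (#|D|%:R * (2^-1 : R) ^+ #|[set i | on y i]|).
  rewrite mulr_natl -sumr_const mulr_sumr -sumrB; apply: eq_bigr => y _.
  rewrite lnM ?posrE ?exprn_gt0 ?invr_gt0 // lnXn ?invr_gt0 // lnV ?posrE //.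
  rewrite -natr_sum -big_mkcond sum1dep_card mulNrn mulr_natr.
  by congr (_ - _ *+ _); apply: eq_card => i; rewrite !inE.
apply: (@le_trans _ _ (\sum_(y in D) (#|D|%:R * (2^-1 : R) ^+ #|[set i | on y i]| - 1))).
  apply: ler_sum => y _.
  set z := _ * _; have z0 : 0 < z by rewrite mulr_gt0 ?exprn_gt0 ?invr_gt0.
  rewrite -[X in ln X](addrNK 1) addrC; apply: le_ln1Dx; lra.
rewrite sumrB sumr_const -mulr_sumr subr_le0 ler_piMr ?(ltW dR) //.
Qed.
End Hansel.

(** * Sampling codewords *)

Section TupleSum.
Variables (R : realType) (X : finType) (D : {set X}).
Implicit Types (Phi Psi : seq X -> R).

(** Sampling is with replacement, so that the letters at a coordinate are independent;
    [tuple_sum_not_uniq] controls the repetitions. *)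
Fixpoint tuple_sum (h : nat) Phi : R :=
  if h is h'.+1 then \sum_(x in D) tuple_sum h' (fun s => Phi (x :: s))
  else Phi [::].

Lemma ler_tuple_sum h Phi Psi :
  (forall s, size s = h -> all (mem D) s -> Phi s <= Psi s) ->
  tuple_sum h Phi <= tuple_sum h Psi.
Proof.
elim: h Phi Psi => [|h IH] Phi Psi le /=; first exact: le.
apply: ler_sum => x xD; apply: IH => s sh sD; apply: le => /=; first by rewrite sh.
by rewrite sD andbT.
Qed.

Lemma eq_tuple_sum h Phi Psi : Phi =1 Psi -> tuple_sum h Phi = tuple_sum h Psi.
Proof.
by move=> e; apply/eqP; rewrite eq_le !ler_tuple_sum // => s _ _; rewrite e.
Qed.

Lemma tuple_sum_exchange h (I : Type) (r : seq I) (P : pred I) (F : I -> seq X -> R) :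
  tuple_sum h (fun s => \sum_(i <- r | P i) F i s) =
  \sum_(i <- r | P i) tuple_sum h (F i).
Proof.
elim: h F => [|h IH] F //=; rewrite exchange_big /=.
by apply: eq_bigr => x _; rewrite IH.
Qed.

Lemma tuple_sumZ h c Phi : tuple_sum h (fun s => c * Phi s) = c * tuple_sum h Phi.
Proof.
elim: h Phi => [|h IH] Phi //=; rewrite mulr_sumr.
by apply: eq_bigr => x _; rewrite IH.
Qed.

Lemma tuple_sumD h Phi Psi :
  tuple_sum h (fun s => Phi s + Psi s) = tuple_sum h Phi + tuple_sum h Psi.
Proof.
elim: h Phi Psi => [|h IH] Phi Psi //=; rewrite -big_split.
by apply: eq_bigr => x _; rewrite IH.
Qed.

Lemma tuple_sum_cst h c : tuple_sum h (fun=> c) = #|D|%:R ^+ h * c.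
Proof.
elim: h => [|h IH] /=; first by rewrite mul1r.
by rewrite IH sumr_const exprS -mulrA mulr_natl.
Qed.

(** Either the head occurs in the tail, which leaves at most [h] choices for it, or the tail itself
    has a repetition. *)
Lemma tuple_sum_not_uniq h :
  #|D|%:R * tuple_sum h (fun s => (~~ uniq s)%:R) <= (h * h)%:R * #|D|%:R ^+ h.
Proof.
elim: h => [|h IH]; first by rewrite /= mulr0 mul0r.
have cons_le : tuple_sum h.+1 (fun s => (~~ uniq s)%:R) <=
    tuple_sum h (fun s => \sum_(x in D) (x \in s)%:R) +
    #|D|%:R * tuple_sum h (fun s => (~~ uniq s)%:R).
  rewrite tuple_sum_exchange [in leLHS]/=.
  rewrite [X in _ <= _ + X]mulr_natl -sumr_const -big_split; apply: ler_sum => x _ /=.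
  rewrite -tuple_sumD; apply: ler_tuple_sum => s _ _ /=.
  by rewrite negb_and negbK; case: (x \in s); case: (uniq s); rewrite /= ?addr0 ?add0r ?lerDl.
have mem_le : tuple_sum h (fun s => \sum_(x in D) (x \in s)%:R) <= h%:R * #|D|%:R ^+ h.
  rewrite mulrC -tuple_sum_cst; apply: ler_tuple_sum => s <- _.
  rewrite -natr_sum ler_nat -big_mkcondr /= sum1dep_card.
  apply: leq_trans (card_size s); apply: subset_leq_card.
  by apply/fintype.subsetP => x; rewrite !inE => /andP[].
have d0 : 0 <= #|D|%:R :> R by [].
apply: (le_trans (ler_wpM2l d0 cons_le)); rewrite mulrDr.
have := ler_wpM2l d0 mem_le; have := ler_wpM2l d0 IH.
have : 0 <= h.+1%:R * #|D|%:R ^+ h.+1 :> R by rewrite mulr_ge0 ?exprn_ge0.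
rewrite !natrM -!natr1 exprS.
set t1 := tuple_sum _ _; set t2 := tuple_sum _ _; set e := _ ^+ h; lra.
Qed.

Section Color.
Variables (T : finType) (c : X -> T).

Definition color_count (a : T) : R := #|[set x in D | c x == a]|%:R.

Lemma sum_by_color (F : T -> R) :
  \sum_(x in D) F (c x) = \sum_a color_count a * F a.
Proof.
rewrite (partition_big c xpredT) //=; apply: eq_bigr => a _.
rewrite (eq_bigr (fun=> F a)) => [|x /andP[_ /eqP->]] //.
by rewrite sumr_const mulr_natl; congr (_ *+ _); apply: eq_card => x; rewrite !inE.
Qed.

(** The letter of the first word is struck off the set allowed to the others, as in the recursion of
    [inj_sum]. *)
Lemma tuple_sum_rainbow h (A : {set T}) :
  tuple_sum h (fun s => (uniq (map c s) && all (fun x => c x \in A) s)%:R) =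
  inj_sum color_count h A.
Proof.
elim: h A => [|h IH] A //.
rewrite [RHS]/= big_mkcond /=.
transitivity (\sum_(x in D) (if c x \in A then inj_sum color_count h (A :\ c x) else 0)).
  apply: eq_bigr => x _; case: ifPn => cx.
    rewrite -IH; apply: eq_tuple_sum => s /=; congr (_%:R).
    have -> : all (fun y => c y \in A :\ c x) s =
        (c x \notin map c s) && all (fun y => c y \in A) s.
      elim: s => //= y s ->; rewrite !inE negb_or (eq_sym (c x)).
      by case: (c y == c x); case: (c x \in _); case: (c y \in A).
    by case: (c x \in _); case: uniq.
  rewrite (@eq_tuple_sum h _ (fun=> 0)) => [|s]; first by rewrite tuple_sum_cst mulr0.
  by rewrite /= andbF.
rewrite (sum_by_color (fun a => if a \in A then inj_sum color_count h (A :\ a) else 0)).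
by apply: eq_bigr => a _; case: ifP => // _; rewrite mulr0.
Qed.

Definition freq (a : T) : R := color_count a / #|D|%:R.

Lemma freq_ge0 a : 0 <= freq a.
Proof. by rewrite divr_ge0 // ler0n. Qed.

Lemma sum_freq : (0 < #|D|)%N -> \sum_a freq a = 1.
Proof.
move=> D0; rewrite -mulr_suml.
have := sum_by_color (fun=> 1); under [in RHS]eq_bigr do rewrite mulr1.
by move=> <-; rewrite sumr_const divff // pnatr_eq0 -lt0n.
Qed.

Lemma color_countE a : (0 < #|D|)%N -> color_count a = #|D|%:R * freq a.
Proof.
by move=> D0; rewrite /freq mulrC divfK // pnatr_eq0 -lt0n.
Qed.

End Color.
End TupleSum.

(** * Hansel's lemma for hash codes, averaged over sampled codewords *)

Section HashCode.
Variables (R : realType) (h n : nat) (C : {set word h.+2 n}).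
Hypothesis hashC : is_hash_code C.
Let T := 'I_h.+2.

Lemma hash_code_separates (s : seq (word h.+2 n)) :
  uniq s -> size s = h.+2 -> {subset s <= C} -> exists j, uniq [seq (x : word _ _) j | x <- s].
Proof.
move=> us ss sC.
have [x0 x0s] : exists x, x \in s.
  by case: s ss {us sC} => // x s _; exists x; rewrite inE eqxx.
pose f (i : T) := nth x0 s i.
have fi : injective f.
  move=> i j /eqP; rewrite nth_uniq ?ss ?ltn_ord // => /eqP; exact: val_inj.
have fC i : f i \in C by apply: sC; rewrite mem_nth // ss.
have [j fj] := hashC fi fC; exists j.
apply: (@leq_size_uniq _ (enum T)); first exact: enum_uniq.
  move=> a _; have : a \in [set f i j | i : 'I_h.+2] by rewrite fj inE.
  by case/imsetP => i _ ->; apply: map_f; rewrite mem_nth // ss.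
by rewrite size_map ss -cardE card_ord.
Qed.

Definition colors (s : seq (word h.+2 n)) (j : 'I_n) : seq T :=
  [seq (x : word _ _) j | x <- s].

(** A coordinate where [s] has distinct letters misses exactly two letters, which give the two sides
    of a bipartite graph on the other words of [C]. The words of [s] only add nonnegative terms on
    the right. *)
Lemma hansel_hash_code (s : seq (word h.+2 n)) :
  uniq s -> size s = h -> {subset s <= C} ->
  (#|C| - h)%:R * ln (#|C| - h)%:R <=
  ln 2 * \sum_j \sum_(y in C)
    (uniq (colors s j) && ((y : word _ _) j \notin colors s j))%:R :> R.
Proof.
move=> us ss sC.
pose V := C :\: [set x in s].
pose on (y : word h.+2 n) j := uniq (colors s j) && (y j \notin colors s j).
pose side (y : word h.+2 n) j := [pick a | a \notin colors s j] == Some (y j).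
have cV : (#|C| - h)%N = #|V|.
  rewrite cardsD; congr (_ - _)%N.
  rewrite -[LHS]ss -(card_uniqP us); apply: eq_card => x; rewrite !inE.
  by case: (boolP (x \in s)) => [/sC->|]; rewrite ?andbT ?andbF.
rewrite cV.
have sep : {in V &, forall y z, y != z ->
    exists i, [&& on y i, on z i & side y i != side z i]}.
  move=> y z; rewrite !inE => /andP[ys yC] /andP[zs zC] yz.
  have [||x|j] := @hash_code_separates (y :: z :: s).
  - by rewrite /= inE negb_or yz ys zs us.
  - by rewrite /= ss.
  - by rewrite !inE => /or3P[/eqP->|/eqP->|/sC].
  rewrite /= inE negb_or => /and3P[/andP[yzj ysj] zsj usj].
  exists j; rewrite /on /colors usj ysj zsj /=.
  (* With [s], the words [y] and [z] exhaust the alphabet, so the picked missing letter belongs to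
     exactly one of them. *)
  have cover a : a \in [:: y j, z j & colors s j].
    have ul : uniq [:: y j, z j & colors s j] by rewrite /= inE negb_or yzj ysj zsj usj.
    have sz : (size (enum T) <= size [:: y j, z j & colors s j])%N.
      by rewrite -cardE card_ord /= size_map ss.
    have sub : {subset [:: y j, z j & colors s j] <= enum T}.
      by move=> b _; rewrite mem_enum.
    have [_ e] := uniq_min_size ul sub sz.
    by rewrite e mem_enum.
  rewrite /side /colors; case: pickP => [a as_|/(_ (y j))]; last by rewrite ysj.
  have := cover a; rewrite !inE (negPf as_) orbF => /orP[]/eqP->.
    by rewrite eqxx; apply: contra yzj => /eqP/esym/eqP[->].
  by rewrite eqxx eq_sym; apply: contra yzj => /eqP/esym/eqP[->].
apply: (le_trans (hansel R sep)).
rewrite ler_wpM2l ?ln_ge0 ?ler1n //; apply: ler_sum => j _.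
rewrite [leRHS](bigID (mem V)) /= [X in _ <= X + _](eq_bigl (mem V)).
  by rewrite lerDl sumr_ge0.
by move=> y; rewrite !inE; case: (y \in C); rewrite ?andbF ?andbT.
Qed.

(** Sum the previous bound over all [h]-tuples of [D]. Those with repetitions count as 0 on the left
    and are at most a fraction [h * h / #|D|] of all tuples. *)
Lemma sampled_hansel (D : {set word h.+2 n}) :
  D \subset C -> (0 < #|D|)%N -> (h < #|C|)%N ->
  (#|D|%:R - (h * h)%:R) * ((#|C| - h)%:R * ln (#|C| - h)%:R) <=
  ln 2 * #|C|%:R * #|D|%:R *
    \sum_j mixed_sum (freq R D (fun x : word _ _ => x j))
                     (freq R C (fun x : word _ _ => x j)) h.
Proof.
move=> DC D0 hC.
have C0 : (0 < #|C|)%N by exact: leq_trans hC.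
set X := (X in _ * X <= _).
have d0 : 0 < #|D|%:R :> R by rewrite ltr0n.
have X0 : 0 <= X by rewrite mulr_ge0 // ln_ge0 // ler1n subn_gt0.
pose col j (x : word h.+2 n) := x j.
have up : X * tuple_sum D h (fun s => (uniq s)%:R) <=
   ln 2 * (#|C|%:R * #|D|%:R ^+ h * \sum_j mixed_sum (freq R D (col j)) (freq R C (col j)) h).
  have -> : #|C|%:R * #|D|%:R ^+ h *
      (\sum_j mixed_sum (freq R D (col j)) (freq R C (col j)) h) =
    tuple_sum D h (fun s => \sum_j \sum_(y in C)
      (uniq (colors s j) && (y j \notin colors s j))%:R).
    rewrite tuple_sum_exchange mulr_sumr; apply: eq_bigr => j _.
    rewrite tuple_sum_exchange.
    transitivity (\sum_(y in C) inj_sum (color_count R D (col j)) h ([set: T] :\ col j y)).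
      rewrite (sum_by_color C (col j)
        (fun b => inj_sum (color_count R D (col j)) h ([set: T] :\ b))).
      rewrite /mixed_sum mulr_sumr; apply: eq_bigr => b _.
      rewrite color_countE // (@eq_inj_sum _ _ (color_count R D (col j))
        (fun a => #|D|%:R * freq R D (col j) a)); last by move=> a; rewrite color_countE.
      by rewrite inj_sumZ; ring.
    apply: eq_bigr => y _; rewrite -tuple_sum_rainbow; apply: eq_tuple_sum => s.
    congr ((_ && _)%:R); symmetry; apply/idP/allP => [ys x xs | all_s].
      rewrite !inE andbT; apply: contraNneq ys => e.
      by apply/mapP; exists x.
    apply/mapP => -[x xs e]; have := all_s x xs.
    by rewrite !inE andbT /col e eqxx.
  rewrite -!tuple_sumZ; apply: ler_tuple_sum => s sh sD.
  case: (boolP (uniq s)) => us.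
    rewrite mulr1; apply: hansel_hash_code => // x xs.
    by apply: (fintype.subsetP DC); exact: (allP sD).
  rewrite mulr0 mulr_ge0 ?ln_ge0 ?ler1n //.
  by apply: sumr_ge0 => j _; apply: sumr_ge0.
have uq : (#|D|%:R - (h * h)%:R) * #|D|%:R ^+ h <=
    #|D|%:R * tuple_sum D h (fun s => (uniq s)%:R) :> R.
  have := tuple_sum_not_uniq R D h.
  have e : tuple_sum D h (fun s => (uniq s)%:R : R) +
     tuple_sum D h (fun s => (~~ uniq s)%:R) = #|D|%:R ^+ h.
    rewrite -tuple_sumD -[RHS]mulr1 -tuple_sum_cst; apply: eq_tuple_sum => s.
    by case: uniq; rewrite /= ?addr0 ?add0r.
  rewrite -e; lra.
rewrite -(ler_pM2r (exprn_gt0 h d0)).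
apply: (@le_trans _ _ (#|D|%:R * (X * tuple_sum D h (fun s => (uniq s)%:R)))).
  by rewrite mulrAC [leLHS]mulrC [leRHS]mulrCA ler_wpM2l.
apply: (le_trans (ler_wpM2l (ltW d0) up)).
by rewrite le_eqVlt; apply/orP; left; apply/eqP; rewrite /col; ring.
Qed.

(** Two words sampled from [D] already share their letter at [j]. *)
Lemma mixed_sum_const_color (D : {set word h.+2 n}) (j : 'I_n) (f : T -> R) :
  (1 < h)%N -> {in D &, forall x y : word h.+2 n, x j = y j} ->
  mixed_sum (freq R D (fun x : word _ _ => x j)) f h = 0.
Proof.
move=> h1 cD; rewrite /mixed_sum big1 // => b _.
case: h h1 @T f b D cD => [|[|g]] // _ T' f b D cD.
rewrite /= big1 ?mulr0 // => a _; rewrite mulr_sumr big1 // => a' aa'.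
rewrite mulrA /freq /color_count.
have [->|/finset.set0Pn[x]] := eqVneq [set x in D | x j == a] finset.set0.
  by rewrite cards0 !mul0r.
have [->|/finset.set0Pn[y]] := eqVneq [set x in D | x j == a'] finset.set0.
  by rewrite cards0 !(mul0r, mulr0).
rewrite !inE => /andP[yD /eqP yj] /andP[xD /eqP xj].
by move: aa'; rewrite !inE -xj -yj (cD _ _ xD yD) eqxx.
Qed.

End HashCode.

(** Pigeonhole, one coordinate at a time; once [l] reaches [n] nothing is left to fix. *)
Lemma large_prefix_class (k n : nat) (C : {set word k.+1 n}) (l : nat) :
  exists D : {set word k.+1 n}, [/\ D \subset C, (#|C| <= k.+1 ^ l * #|D|)%N &
    forall j : 'I_n, (j < l)%N -> {in D &, forall x y : word k.+1 n, x j = y j}].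
Proof.
elim: l => [|l [D [DC cD eqD]]]; first by exists C; rewrite mul1n.
case: (ltnP l n) => ln; last first.
  exists D; split => //; first by rewrite expnS -mulnA (leq_trans cD) // leq_pmull.
  by move=> j _; apply: eqD; apply: leq_trans ln.
pose j0 := Ordinal ln.
pose cls (a : 'I_k.+1) := [set x in D | (x : word k.+1 n) j0 == a].
pose a0 := [arg max_(a > ord0) #|cls a|].
exists (cls a0); split.
- by apply: (fintype.subset_trans _ DC); apply/fintype.subsetP => x; rewrite inE => /andP[].
- apply: (leq_trans cD); rewrite expnSr -mulnA leq_mul2l; apply/orP; right.
  have -> : #|D| = (\sum_(a : 'I_k.+1) #|cls a|)%N.
    rewrite -sum1_card (partition_big (fun x : word k.+1 n => x j0) xpredT) //=.
    by apply: eq_bigr => a _; rewrite -sum1_card; apply: eq_bigl => x; rewrite inE.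
  rewrite -[X in (_ <= X * _)%N]card_ord -sum_nat_const; apply: leq_sum => a _.
  by rewrite /a0; case: arg_maxnP => // i _; apply.
- move=> j; rewrite ltnS leq_eqVlt => /orP[/eqP jl|jl] x y; last first.
    by rewrite !inE => /andP[xD _] /andP[yD _]; apply: eqD.
  have -> : j = j0 by apply: val_inj.
  by rewrite !inE => /andP[_ /eqP->] /andP[_ /eqP->].
Qed.

(** * The rate *)

Section SizeBound.
Variables (R : realType) (g n : nat).
Let k := g.+4.
Let h := g.+2.
Let al : R := alpha k.
Let ka : R := kappa R k.

(** Average, with weights [al] and [ka], of the estimates that sample from a prefix class [D] and
    from [C]. The loss from repeated samples is controlled by [#|D| >= #|C| / k ^ l]. *)
Lemma hash_code_ln_bound (C : {set word k n}) (l : nat) :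
  is_hash_code C -> (h < #|C|)%N -> (l <= n)%N ->
  (al + ka) * ((1 - (h * h)%:R * k%:R ^+ l / #|C|%:R) *
    ((#|C| - h)%:R * ln (#|C| - h)%:R)) <=
  ln 2 * #|C|%:R * (al * ((al + ka) * n%:R - al * l%:R)).
Proof.
move=> hC hN ln_.
have [D [DC cD eqD]] := large_prefix_class C l.
have C0 : (0 < #|C|)%N by apply: leq_trans hN.
have D0 : (0 < #|D|)%N by move: (leq_trans C0 cD); rewrite muln_gt0 => /andP[].
have N0 : 0 < #|C|%:R :> R by rewrite ltr0n.
have M0 : 0 < #|D|%:R :> R by rewrite ltr0n.
have al0 : 0 < al by exact: alpha_gt0.
have ka0 : 0 < ka by exact: kappa_gt0.
set X := (#|C| - h)%:R * ln _.
have X0 : 0 <= X by rewrite mulr_ge0 // ln_ge0 // ler1n subn_gt0.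
set eps := _ / #|C|%:R.
pose fC j := freq R C (fun x : word k n => x j).
pose fD j := freq R D (fun x : word k n => x j).
have loss (E : {set word k n}) : E \subset C -> (0 < #|E|)%N ->
    (#|C| <= k ^ l * #|E|)%N ->
    (1 - eps) * X <= ln 2 * #|C|%:R *
      \sum_j mixed_sum (freq R E (fun x : word k n => x j)) (fC j) h.
  move=> EC E0 cE; have e0 : 0 < #|E|%:R :> R by rewrite ltr0n.
  rewrite -(ler_pM2l e0).
  apply: le_trans (_ : (#|E|%:R - (h * h)%:R) * X <= _).
    rewrite mulrA ler_wpM2r // mulrBr mulr1 lerD2l lerN2.
    rewrite /eps mulrA ler_pdivlMr // [leRHS]mulrCA ler_wpM2l //.
    by rewrite -natrX -natrM ler_nat mulnC.
  apply: (le_trans (@sampled_hansel R g.+2 n C hC E EC E0 hN)).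
  by rewrite le_eqVlt; apply/orP; left; apply/eqP; rewrite /fC; ring.
have lossD := loss D DC D0 cD.
have lossC : (1 - eps) * X <= ln 2 * #|C|%:R * \sum_j mixed_sum (fC j) (fC j) h.
  by apply: loss => //; rewrite leq_pmull // expn_gt0.
(* On the first [l] coordinates only the [ka] term remains, at most [ka * al]; this saves
   [al ^ 2]. *)
have pt j : al * mixed_sum (fD j) (fC j) h + ka * mixed_sum (fC j) (fC j) h <=
    al * (al + ka) - (j < l)%:R * al ^+ 2.
  have le1 (p : 'I_k -> R) : (forall a, 0 <= p a) -> \sum_a p a = 1 ->
     al * mixed_sum p (fC j) h + ka * mixed_sum (fC j) (fC j) h <= al * (al + ka).
    move=> p0 p1; apply: (@mixed_sum_le_deficit R _ p (fC j) k) => //.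
    - by rewrite card_ord.
    - by move=> a; exact: freq_ge0.
    - exact: sum_freq.
  case: (boolP (j < l)%N) => jl; last first.
    rewrite mul0r subr0; apply: le1; first by move=> a; exact: freq_ge0.
    exact: sum_freq.
  have -> : mixed_sum (fD j) (fC j) h = 0.
    by apply: mixed_sum_const_color => //; exact: eqD.
  rewrite mulr0 add0r mul1r.
  have fC0 a : 0 <= fC j a by exact: freq_ge0.
  have fC1 : \sum_a fC j a = 1 by exact: sum_freq.
  (* For [p = f] the common factor [al + ka] cancels, leaving the Fredman-Komlos bound. *)
  have := le1 _ fC0 fC1.
  rewrite -mulrDl [leRHS]mulrC ler_pM2l ?addr_gt0 // => A1.
  have := ler_wpM2l (ltW ka0) A1.
  rewrite mulrDr expr2; lra.
apply: (@le_trans _ _ (ln 2 * #|C|%:R *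
    \sum_j (al * mixed_sum (fD j) (fC j) h + ka * mixed_sum (fC j) (fC j) h))).
  rewrite big_split /= -!mulr_sumr.
  have := ler_wpM2l (ltW al0) lossD; have := ler_wpM2l (ltW ka0) lossC.
  rewrite /fD; lra.
rewrite ler_wpM2l ?mulr_ge0 ?ln_ge0 ?ler1n //.
apply: (le_trans (ler_sum _ (fun j _ => pt j))).
rewrite sumrB sumr_const -mulr_suml card_ord.
have -> : \sum_(j < n) (j < l)%:R = l%:R :> R.
  rewrite -natr_sum -big_mkcond -(big_ord_widen _ (fun=> 1%N) ln_).
  by rewrite sum_nat_const card_ord muln1.
by rewrite le_eqVlt; apply/orP; left; apply/eqP; rewrite -mulr_natr; ring.
Qed.

End SizeBound.

(** * From the size bound to the limit superior *)

Section Rate.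
Variable R : realType.

(** For [l] close to [log2 N / log2 k], the saving [alpha k * t * l] is close to [gain k * log2 N];
    the resulting rate bound is [alpha k / (1 + gain k)]. *)
Definition gain (k : nat) : R := alpha k ^+ 2 / ((alpha k + kappa R k) * log2 k%:R).

Lemma ln2_gt0 : 0 < ln 2 :> R.
Proof. by rewrite ln_gt0 // ltr1n. Qed.

Lemma log2_ge0 (m : nat) : 0 <= log2 m%:R :> R.
Proof.
case: m => [|m]; first by rewrite /log2 ln0 // mul0r.
by rewrite divr_ge0 ?(ltW ln2_gt0) // ln_ge0 // ler1n.
Qed.

Lemma log2_gt0 (m : nat) : (1 < m)%N -> 0 < log2 m%:R :> R.
Proof. by move=> m1; rewrite divr_gt0 ?ln2_gt0 // ln_gt0 // ltr1n. Qed.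

Lemma ler_log2_nat (m p : nat) : (m <= p)%N -> log2 m%:R <= log2 p%:R :> R.
Proof.
case: m => [|m] mp; first by rewrite /log2 ln0 // mul0r log2_ge0.
rewrite ler_wpM2r ?invr_ge0 ?(ltW ln2_gt0) //.
by rewrite ler_ln ?posrE ?ltr0n ?ler_nat // (leq_trans _ mp).
Qed.

Lemma gain_gt0 g : 0 < gain g.+4.
Proof.
rewrite /gain divr_gt0 ?exprn_gt0 ?alpha_gt0 // mulr_gt0 ?log2_gt0 //.
by rewrite addr_gt0 ?alpha_gt0 ?kappa_gt0.
Qed.

(** [N - h] is at least [(1 - 1 / q) * N], used for the factor, and at least [N / 2], used inside
    the logarithm. *)
Lemma ln_sub_lower_bound (N h q : nat) : (1 < q)%N -> (0 < h)%N -> (h * q <= N)%N ->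
  (1 - q%:R^-1) * N%:R * (ln N%:R - ln 2) <= (N - h)%:R * ln (N - h)%:R :> R.
Proof.
move=> q1 h0 hqN.
have q0 : 0 < q%:R :> R by rewrite ltr0n ltnW.
have hN : (h <= N)%N by apply: leq_trans hqN; rewrite leq_pmulr // ltnW.
have N2 : (2 <= N)%N by apply: leq_trans hqN; apply: (leq_trans q1); rewrite leq_pmull.
have h2N : (h * 2 <= N)%N by apply: leq_trans hqN; rewrite leq_mul2l q1 orbT.
have N0 : 0 < N%:R :> R by rewrite ltr0n (leq_trans _ N2).
have d0 : (0 < N - h)%N.
  by rewrite subn_gt0; apply: leq_trans h2N; rewrite muln2 -addnn -addn1 leq_add2l.
apply: ler_pM.
- by rewrite mulr_ge0 ?(ltW N0) // subr_ge0 invf_le1 // ler1n ltnW.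
- by rewrite subr_ge0 ler_ln ?posrE ?ler_nat.
- rewrite natrB // mulrBl mul1r lerD2l lerN2 mulrC ler_pdivlMr //.
  by rewrite -natrM ler_nat.
- have half : N%:R / 2 <= (N - h)%:R :> R.
    rewrite ler_pdivrMr // -natrM ler_nat mulnBl leq_subRL.
      by rewrite addnC [X in (_ <= X)%N]muln2 -addnn leq_add2l.
    by rewrite leq_mul2r hN orbT.
  rewrite -ln_div ?posrE // ler_ln ?posrE //; first by rewrite divr_gt0.
  by rewrite ltr0n.
Qed.

(** [M] does not depend on [n]. One factor [1 - 1 / q] pays for repeated samples, the other for the
    [h] words removed in Hansel's bound. *)
Lemma log2_hash_code_bound g q : (1 < q)%N -> exists M : R,
  forall n (C : {set word g.+4 n}), is_hash_code C ->
  log2 #|C|%:R * ((1 - q%:R^-1) ^+ 2 + gain g.+4) <= alpha g.+4 * n%:R + M.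
Proof.
have combine (x t b y a r2 c : R) : t * (x - b) <= y -> r2 * (x - 1) <= a - y ->
    r2 <= 1 -> 0 <= c -> x * (r2 + t) <= a + (c + 1 + t * b) by lra.
move=> q1; set k := g.+4; set h := g.+2; set tau := gain k.
have tau0 : 0 < tau by exact: gain_gt0.
pose c := (h * h * q)%N.
pose b1 : R := log2 c%:R; pose b2 : R := log2 (c * k)%:R.
have b10 : 0 <= b1 by exact: log2_ge0.
have b20 : 0 <= b2 by exact: log2_ge0.
have q0 : 0 < q%:R :> R by rewrite ltr0n ltnW.
have qv0 : 0 < q%:R^-1 :> R by rewrite invr_gt0.
have qv1 : q%:R^-1 <= 1 :> R by rewrite invf_le1 // ler1n ltnW.
set r := (1 - _ : R).
have r0 : 0 <= r by rewrite subr_ge0.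
have r1 : r ^+ 2 <= 1 by rewrite expr_le1 // /r lerBlDr lerDl ltW.
have al0 : 0 < alpha k :> R by exact: alpha_gt0.
have ka0 : 0 < kappa R k by exact: kappa_gt0.
(* [b1 * (1 + tau)] covers codes smaller than [c], 1 the loss of [ln 2], and [tau * b2] the rounding
   of [l]. *)
exists (b1 * (1 + tau) + 1 + tau * b2) => n C hC.
set N := #|C|; set L := log2 _.
have an : 0 <= alpha k * n%:R :> R by rewrite mulr_ge0 // ltW.
have tb : 0 <= tau * b2 by rewrite mulr_ge0 // ltW.
have [Nc|cN] := ltnP N c.
  have L1 : L <= b1 by apply: ler_log2_nat; exact: ltnW.
  have : L * (r ^+ 2 + tau) <= b1 * (1 + tau).
    apply: ler_pM => //; first exact: log2_ge0.
      by rewrite addr_ge0 ?sqr_ge0 // ltW.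
    by rewrite lerD2r.
  lra.
have c0 : (0 < c)%N by rewrite !muln_gt0 /= ltnW.
have N0 : (0 < N)%N by exact: leq_trans cN.
have NR : 0 < N%:R :> R by rewrite ltr0n.
(* The largest [l] with [c * k ^ l <= N]: the repetition loss is at most [1 / q], yet [k ^ l] is
   within a constant factor of [N]. *)
pose l := trunc_log k (N %/ c).
have kl : (k ^ l * c <= N)%N.
  by rewrite -leq_divRL //; apply: trunc_logP => //; rewrite divn_gt0.
have Nkl : (N < c * k * k ^ l)%N.
  by have := @trunc_log_ltn k (N %/ c) isT; rewrite ltn_divLR // expnS mulnC mulnA.
have ln_ : (l <= n)%N.
  have : (k ^ l <= k ^ n)%N.
    apply: (@leq_trans N); first by apply: leq_trans kl; rewrite leq_pmulr.
    by apply: (leq_trans (max_card _)); rewrite card_ffun !card_ord.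
  by rewrite leq_exp2l.
have hqN : (h * q <= N)%N by apply: leq_trans cN; rewrite /c -mulnA leq_pmull.
have hN : (h < N)%N.
  apply: leq_trans hqN; apply: (@leq_trans (h * 2)); rewrite ?leq_mul2l ?q1 //.
  by rewrite muln2 -addnn -addn1 leq_add2l.
have B := @hash_code_ln_bound R g n C l hC hN ln_.
rewrite -/N -/h -/k in B.
have X := ln_sub_lower_bound q1 (isT : (0 < h)%N) hqN.
have eps : r <= 1 - (h * h)%:R * k%:R ^+ l / N%:R.
  rewrite /r lerD2l lerN2 ler_pdivrMr // -ler_pdivrMl ?invr_gt0 // invrK.
  by rewrite -natrX -!natrM ler_nat mulnC mulnAC -/c mulnC.
have B1 : (alpha k + kappa R k) * (r ^+ 2 * (ln N%:R - ln 2)) <=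
   ln 2 * (alpha k * ((alpha k + kappa R k) * n%:R - alpha k * l%:R)).
  rewrite -(ler_pM2l NR).
  apply: (@le_trans _ _ ((alpha k + kappa R k) * (r * (r * N%:R * (ln N%:R - ln 2))))).
    by rewrite le_eqVlt; apply/orP; left; apply/eqP; ring.
  rewrite [leRHS]mulrA [N%:R * ln 2]mulrC; apply: le_trans B.
  rewrite ler_wpM2l ?addr_ge0 ?(ltW al0) ?(ltW ka0) //.
  apply: ler_pM => //; rewrite mulr_ge0 ?mulr_ge0 ?(ltW NR) // subr_ge0.
  by rewrite ler_ln ?posrE // ler_nat (leq_trans _ hN).
have lk0 : 0 < log2 k%:R :> R by exact: log2_gt0.
have Ll : L - b2 <= l%:R * log2 k%:R.
  rewrite lerBlDl /L /b2 /log2 mulrA -mulrDl ler_wpM2r ?invr_ge0 ?(ltW ln2_gt0) //.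
  have ck0 : 0 < (c * k)%:R :> R by rewrite ltr0n muln_gt0 c0.
  have k0 : 0 < k%:R :> R by rewrite ltr0n.
  rewrite mulr_natl -lnXn // -lnM ?posrE ?exprn_gt0 // ler_ln ?posrE ?mulr_gt0 ?exprn_gt0 //.
  by rewrite -natrX -natrM ler_nat ltnW.
have s0 : 0 < alpha k + kappa R k by exact: addr_gt0.
have tl : tau * (L - b2) <= alpha k ^+ 2 / (alpha k + kappa R k) * l%:R.
  have -> : alpha k ^+ 2 / (alpha k + kappa R k) * l%:R = tau * (l%:R * log2 k%:R).
    by rewrite /tau /gain; field; rewrite !gt_eqF.
  by rewrite ler_wpM2l // ltW.
have B2 : r ^+ 2 * (L - 1) <= alpha k * n%:R - alpha k ^+ 2 / (alpha k + kappa R k) * l%:R.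
  rewrite -(ler_pM2l s0) -(ler_pM2l ln2_gt0).
  have -> : ln 2 * ((alpha k + kappa R k) * (r ^+ 2 * (L - 1))) =
     (alpha k + kappa R k) * (r ^+ 2 * (ln N%:R - ln 2)).
    by rewrite /L /log2; field; rewrite gt_eqF // ln2_gt0.
  apply: (le_trans B1); rewrite le_eqVlt; apply/orP; left; apply/eqP.
  by field; rewrite gt_eqF.
have b1t : 0 <= b1 * (1 + tau) by rewrite mulr_ge0 // addr_ge0 // ltW.
exact: combine tl B2 r1 b1t.
Qed.

Lemma log2_max_hash_size_bound g q : (1 < q)%N -> exists M : R, forall n,
  log2 (max_hash_size g.+4 n)%:R * ((1 - q%:R^-1) ^+ 2 + gain g.+4) <=
  alpha g.+4 * n%:R + M.
Proof.
move=> /(@log2_hash_code_bound g)[M HM]; exists M => n.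
apply: (big_ind (fun N : nat => log2 N%:R * _ <= _)).
(* The default 0 of the maximum is the size of the empty code, vacuously a hash code. *)
- have := HM n finset.set0; rewrite cards0; apply.
  by move=> f _ /(_ ord0); rewrite inE.
- by move=> x y hx hy; case: (leqP x y).
- by move=> C /asboolP; exact: HM.
Qed.

(** The slack [d] in the strict hypothesis absorbs the loss in [(1 - 1 / q) ^ 2] for large [q], then
    [M] for large [n]. *)
Lemma Rk_le g (beta : R) : alpha g.+4 < beta * (1 + gain g.+4) ->
  (Rk g.+4 <= beta%:E)%E.
Proof.
set al := alpha _; set tau := gain _ => ab.
have tau0 : 0 < tau by exact: gain_gt0.
have al0 : 0 < al by exact: alpha_gt0.
have beta0 : 0 < beta.
  have : 0 < beta * (1 + tau) by apply: lt_trans ab.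
  by rewrite pmulr_lgt0 // addr_gt0.
pose d := beta * (1 + tau) - al; have d0 : 0 < d by rewrite subr_gt0.
(* Chosen so that [2 * beta / q < d], as [(1 - 1 / q) ^ 2 >= 1 - 2 / q]. *)
pose q := (Num.truncn (2 * beta / d)).+2.
have q0 : 0 < q%:R :> R by rewrite ltr0n.
have qd : 2 * beta / d < q%:R.
  by apply: (lt_trans (truncnS_gt _)); rewrite ltr_nat.
have [M HM] := @log2_max_hash_size_bound g q isT.
set s := (_ ^+ 2 + _) in HM.
have s0 : 0 < s by rewrite ltr_wpDl ?sqr_ge0.
have as_ : al < beta * s.
  have : 2 * beta * q%:R^-1 < d by rewrite ltr_pdivrMr // [ltRHS]mulrC -ltr_pdivrMr.
  have : 0 <= beta * q%:R^-1 ^+ 2.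
    by rewrite mulr_ge0 ?(ltW beta0) ?exprn_ge0 ?invr_ge0 ?(ltW q0).
  rewrite /s /d -/tau; set v := _^-1; lra.
pose n0 := (Num.truncn (M / (beta * s - al))).+1.
have u0 : 0 < beta * s - al by rewrite subr_gt0.
have Mn n : (n0 <= n)%N -> M <= (beta * s - al) * n%:R.
  move=> n0n; rewrite mulrC -ler_pdivrMr //.
  by apply: (le_trans (ltW (truncnS_gt _))); rewrite ler_nat.
rewrite /Rk /limn_esup.
apply: (@le_trans _ _ (ereal_sup
  ((fun n => (hash_rate (R := R) g.+4 n)%:E) @` [set n | (n0 <= n)%N])%classic)).
  by apply: ereal_inf_lbound; exists [set n | (n0 <= n)%N]%classic => //; exists n0.
apply: ge_ereal_sup => _ [n /= n0n <-]; rewrite lee_fin.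
case: n n0n => // n n0n; rewrite /hash_rate ler_pdivrMr ?ltr0n //.
rewrite -(ler_pM2r s0); apply: (le_trans (HM _)).
have := Mn _ n0n; rewrite -/al; move: (n.+1%:R) => x; lra.
Qed.

(** [gain] decreases in [log2 k], so a rational upper bound [b] suffices and the condition becomes
    rational. *)
Lemma alpha_gain_lt (k : nat) (beta a t b : R) : alpha k = a ->
  kappa R k = t -> log2 k%:R < b -> 0 < a -> 0 < t -> 0 < log2 k%:R :> R ->
  0 < beta -> a * ((a + t) * b) < beta * ((a + t) * b + a ^+ 2) ->
  alpha k < beta * (1 + gain k).
Proof.
move=> ea et lb a0 t0 l0 be0 H; rewrite /gain ea et.
have b0 : 0 < b by exact: lt_trans lb.
have s0 : 0 < a + t by exact: addr_gt0.
have le : a ^+ 2 / ((a + t) * b) <= a ^+ 2 / ((a + t) * log2 k%:R).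
  rewrite ler_wpM2l ?sqr_ge0 // lef_pV2 ?posrE ?(mulr_gt0 s0 b0) ?(mulr_gt0 s0 l0) //.
  by rewrite ler_pM2l // ltW.
have le2 : beta * (1 + a ^+ 2 / ((a + t) * b)) <=
    beta * (1 + a ^+ 2 / ((a + t) * log2 k%:R)).
  by rewrite ler_wpM2l ?(ltW be0) // lerD2l.
apply: (lt_le_trans _ le2).
rewrite -(ltr_pM2r (mulr_gt0 s0 b0)); apply: (lt_le_trans H).
by rewrite le_eqVlt; apply/orP; left; apply/eqP; field; rewrite !gt_eqF.
Qed.

Lemma log2_lt (k i j : nat) : (0 < k)%N -> (0 < j)%N -> (k ^ j < 2 ^ i)%N ->
  log2 k%:R < i%:R / j%:R :> R.
Proof.
move=> k0 j0 kij; rewrite /log2 ltr_pdivrMr ?ln2_gt0 // mulrAC ltr_pdivlMr ?ltr0n //.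
rewrite mulr_natr mulr_natl -!lnXn ?ltr0n // ltr_ln ?posrE ?exprn_gt0 ?ltr0n //.
by rewrite -!natrX ltr_nat.
Qed.

End Rate.

(** * Numerical values and conclusion *)

Lemma alpha5 (R : realType) : alpha 5 = 192 / 1000 :> R.
Proof. rewrite /alpha !factS fact0 natrX !natrM; by field. Qed.

Lemma alpha6 (R : realType) : alpha 6 = 5 / 54 :> R.
Proof. rewrite /alpha !factS fact0 natrX !natrM; by field. Qed.

Lemma kappa5 (R : realType) : kappa R 5 = 1.
Proof. by rewrite /kappa /= !factS fact0; field. Qed.

Lemma kappa6 (R : realType) : kappa R 6 = 5 / 8.
Proof. by rewrite /kappa /= !factS fact0; field. Qed.

(* 0.190825 = (190*1000 + 825) / 10^6 ; 0.192 = 192 / 1000 ;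
   0.0922787 = (922*1000 + 787) / 10^7  (written this way to avoid
   huge unary nat literals) *)
Theorem theorem1 (R : realType) :
  (forall k : nat, (4 <= k)%N ->
     exists beta : R, (Rk (R:=R) k <= beta%:E)%E /\ beta < alpha k)
  /\ ((Rk (R:=R) 5 < ((190 * 1000 + 825) / 10 ^+ 6 : R)%:E)%E
      /\ ((190 * 1000 + 825) / 10 ^+ 6 : R) < 192 / 1000
      /\ (192 / 1000 : R) = alpha 5)
  /\ ((Rk (R:=R) 6 < ((922 * 1000 + 787) / 10 ^+ 7 : R)%:E)%E
      /\ ((922 * 1000 + 787) / 10 ^+ 7 : R) < 5 / 54
      /\ (5 / 54 : R) = alpha 6).
Proof.
split; [|split; split; [| split | | split]].
- case=> [|[|[|[|g]]]] // _.
  have al0 := alpha_gt0 R g.+4; have t0 := gain_gt0 R g.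
  (* Strictly between 1 and [1 + gain], as both strict inequalities require. *)
  pose c := 1 + gain R g.+4 / 2.
  have c1 : 1 < c by rewrite ltrDl divr_gt0.
  have c0 : 0 < c by apply: lt_trans c1.
  exists (alpha g.+4 / c); split; last by rewrite ltr_pdivrMr // ltr_pMr.
  apply: Rk_le; rewrite mulrAC ltr_pdivlMr // ltr_pM2l // ltrD2l.
  by rewrite ltr_pdivrMr // ltr_pMr // ltr1n.
(* [Rk_le] is not strict, so a smaller rational is interposed. Here [5 ^ 3 = 125 < 128 = 2 ^ 7]
   gives [log2 5 < 7 / 3]. *)
- apply: (@le_lt_trans _ _ (19 / 100 : R)%:E); last by rewrite lte_fin; lra.
  have lb := @log2_lt R 5 7 3 isT isT isT.
  apply: Rk_le; apply: (alpha_gain_lt (alpha5 R) (kappa5 R) lb).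
  + lra.
  + lra.
  + exact: log2_gt0.
  + lra.
  + lra.
- lra.
- by rewrite alpha5.
(* Likewise [6 ^ 5 = 7776 < 8192 = 2 ^ 13] gives [log2 6 < 13 / 5]. *)
- apply: (@le_lt_trans _ _ (59 / 640 : R)%:E); last by rewrite lte_fin; lra.
  have lb := @log2_lt R 6 13 5 isT isT isT.
  apply: Rk_le; apply: (alpha_gain_lt (alpha6 R) (kappa6 R) lb).
  + lra.
  + lra.
  + exact: log2_gt0.
  + lra.
  + lra.
- lra.
- by rewrite alpha6.
Qed.
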